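(* Let $m,n\geq 1$ be integers, let $\Bbbk$ be a field, and let $\omega$ be an edge-weighting on the complete bipartite graph $K_{m,n}$ with partite sets $\{X_1,\ldots,X_m\}$ and $\{Y_1,\ldots,Y_n\}$. Let $S=\Bbbk[X_1,\ldots,X_m,Y_1,\ldots,Y_n]$ and let $\mathcal{E}(K_{m,n}^\omega)\subseteq S$ be the weighted edge ideal. Set $\alpha=\min\{\omega(X_iY_j)\mid i=1,\ldots,m;\ j=1,\ldots,n\}$. Then Visscher's chain complex $F_{m,n}^\omega$ is a (cellular, minimal) free resolution of $S/\mathcal{E}(K_{m,n}^\omega)$ if and only if one of the following conditions holds: (1) $m=1$ or $n=1$; or (2) $m,n\geq 2$ and there is a vertex $v$ of $K_{m,n}$ such that (2.a) $\omega(vw)=\alpha$ for all vertices $w$ adjacent to $v$, and (2.b) Visscher's construction for the edge-weighted graph $K_{m,n}^\omega-v$ yields a (cellular, minimal) free resolution.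
   Context: An edge-weighting on a graph with edge set $E$ is a function $\omega\colon E\to\mathbb{N}=\{1,2,3,\ldots\}$. The edges of $K_{m,n}$ are $X_iY_j$ for $i\in[m]=\{1,\ldots,m\}$, $j\in[n]=\{1,\ldots,n\}$. The edge ideal of the edge-weighted graph $K_{m,n}^\omega$ is the monomial ideal $\mathcal{E}(K_{m,n}^\omega)=\langle (X_iY_j)^{\omega(X_iY_j)}\mid i\in[m],\ j\in[n]\rangle\subseteq S$. Visscher's construction. Visscher's cell complex $V_{m,n}$ has as nonempty faces the pairs $(A,B)$ with $\emptyset\neq A\subseteq[m]$ and $\emptyset\neq B\subseteq[n]$; the face $(A,B)$ has dimension $|A|+|B|-2$, so the vertices are the pairs $(i,j)=(\{i\},\{j\})$. The vertex $(i,j)$ is labeled by the monomial $f_{i,j}=(X_iY_j)^{\omega(X_iY_j)}$, and the face $(A,B)$ is labeled by $f_{A,B}=\operatorname{lcm}(f_{a,b}\mid a\in A,\ b\in B)$. The associated chain complex $F_{m,n}^\omega$ of finite-rank free $S$-modules has $F_{m,n,0}^\omega=S$, and for $d\geq1$ the module $F_{m,n,d}^\omega$ is free with basis the symbols $[A,B]$ with $\emptyset\neq A\subseteq[m]$, $\emptyset\neq B\subseteq[n]$ and $|A|+|B|=d+1$. For $A=\{a_1<\cdots<a_s\}$ and $B=\{b_1<\cdots<b_t\}$ the differential is given by $\partial([\{a\},\{b\}])=f_{a,b}$ and, if $s+t\geq 3$, $$\partial([A,B])=\sum_{i}(-1)^{i-1}\frac{f_{A,B}}{f_{A\smallsetminus\{a_i\},B}}[A\smallsetminus\{a_i\},B]+\sum_{j}(-1)^{s+j-1}\frac{f_{A,B}}{f_{A,B\smallsetminus\{b_j\}}}[A,B\smallsetminus\{b_j\}],$$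 where the first sum is over $i=1,\ldots,s$ if $s\geq2$ and is omitted if $s=1$, and the second sum is over $j=1,\ldots,t$ if $t\geq 2$ and is omitted if $t=1$. A (cellular) resolution: $F_{m,n}^\omega$ is a resolution of $S/\mathcal{E}(K_{m,n}^\omega)$ if $H_i(F_{m,n}^\omega)=0$ for all $i\geq1$ (one always has $H_0(F_{m,n}^\omega)\cong S/\mathcal{E}(K_{m,n}^\omega)$). It is cellular, meaning it is the chain complex associated to the labeled regular cell complex $V_{m,n}$. Minimal means that every entry of the matrices of the differentials lies in the ideal generated by the variables. The graph $K_{m,n}^\omega-v$ is obtained by deleting the vertex $v$ and all edges containing it, with the restricted edge-weighting. When $m,n\geq2$ it is again an edge-weighted complete bipartite graph ($K_{m-1,n}$ if $v$ is some $X_i$, or $K_{m,n-1}$ if $v$ is some $Y_j$), and Visscher's construction for it is the complex above formed from its remaining vertices (re-indexed in order) over the polynomial ring in the remaining variables; ''yields a resolution'' means that this complex is a resolution of the quotient of that polynomial ring by the edge ideal of $K_{m,n}^\omega-v$. *)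

(* Defs.v *)
From HB Require Import structures.
From mathcomp Require Import all_boot all_order all_algebra.
From mathcomp Require Export mpoly.

Set Implicit Arguments.
Unset Strict Implicit.
Unset Printing Implicit Defensive.

Import GRing.Theory.
Local Open Scope ring_scope.

(* A weight function on the edges of K_{m,n} is w : 'I_m -> 'I_n -> nat, where
   w i j is the weight of X_i Y_j; indices start at 0. *)

Definition edge_weighting (m n : nat) (w : 'I_m -> 'I_n -> nat) : Prop :=
  forall i j, (0 < w i j)%N.

Definition is_min_weight (m n : nat) (w : 'I_m -> 'I_n -> nat) (alpha : nat) :
    Prop :=
  (exists i j, w i j = alpha) /\ (forall i j, (alpha <= w i j)%N).

(* Vertices of K_{m,n}: inl i is X_i and inr j is Y_j. *)
Definition vertex (m n : nat) : Type := ('I_m + 'I_n)%type.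

Definition adjacent (m n : nat) (u v : vertex m n) : bool :=
  match u, v with
  | inl _, inr _ | inr _, inl _ => true
  | _, _ => false
  end.

(* The value on non-adjacent pairs is irrelevant. *)
Definition weight (m n : nat) (w : 'I_m -> 'I_n -> nat) (u v : vertex m n) :
    nat :=
  match u, v with
  | inl i, inr j | inr j, inl i => w i j
  | _, _ => 0%N
  end.

Definition in_ideal (R : comNzRingType) (I : finType) (f : I -> R) (p : R) :
    Prop :=
  exists c : I -> R, p = \sum_i c i * f i.

Section Visscher.

Variables (k : fieldType) (m n : nat) (w : 'I_m -> 'I_n -> nat).

Local Notation S := {mpoly k[m + n]}.

Definition varX (i : 'I_m) : S := 'X_(lshift n i).
Definition varY (j : 'I_n) : S := 'X_(rshift m j).

Definition edge_ideal : S -> Prop :=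
  in_ideal (fun e : 'I_m * 'I_n => (varX e.1 * varY e.2) ^+ w e.1 e.2).

(* Exponent vectors of the monomials f_{i,j} and f_{A,B}. *)
Definition vertex_label (i : 'I_m) (j : 'I_n) : 'X_{1..m + n} :=
  ((U_(lshift n i) + U_(rshift m j)) *+ w i j)%MM.

Definition face_label (A : {set 'I_m}) (B : {set 'I_n}) : 'X_{1..m + n} :=
  \big[@mlcm (m + n)/0%MM]_(a in A) \big[@mlcm (m + n)/0%MM]_(b in B)
     vertex_label a b.

Lemma vertex_labelE (i : 'I_m) (j : 'I_n) :
  'X_[vertex_label i j] = (varX i * varY j) ^+ w i j :> S.
Proof. by rewrite /varX /varY -mpolyXD mpolyXn. Qed.

(* Basis of the free module in homological degree d; the only basis element in
   degree 0 is the empty face, so that F_0 = S. *)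
Definition is_face (d : nat) (c : {set 'I_m} * {set 'I_n}) : bool :=
  [&& c.1 != set0, c.2 != set0 & #|c.1| + #|c.2| == d.+1]%N.

Definition face (d : nat) : finType := {c : {set 'I_m} * {set 'I_n} | is_face d c}.

Definition basis (d : nat) : finType := if d is 0%N then unit else face d.

Definition chain (d : nat) : Type := {ffun basis d -> S}.

(* The number of elements of A below a: this is i - 1 if a = a_i. *)
Definition rank_in (N : nat) (A : {set 'I_N}) (a : 'I_N) : nat :=
  #|[set x in A | x < a]%N|.

(* Coefficient of the symbol [A', B'] in the boundary of [A, B] when
   |A| + |B| >= 3. *)
Definition face_coef (c c' : {set 'I_m} * {set 'I_n}) : S :=
  let: (A, B) := c in
    \sum_(a in A | (1 < #|A|)%N && (c' == (A :\ a, B)))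
       (-1) ^+ rank_in A a * 'X_[face_label A B - face_label (A :\ a) B]
  + \sum_(b in B | (1 < #|B|)%N && (c' == (A, B :\ b)))
       (-1) ^+ (#|A| + rank_in B b) * 'X_[face_label A B - face_label A (B :\ b)].

(* Matrix of the differential F_{d+1} -> F_d. *)
Definition boundary_entry (d : nat) : basis d.+1 -> basis d -> S :=
  match d return basis d.+1 -> basis d -> S with
  | 0%N => fun c _ => 'X_[face_label (val c).1 (val c).2]
  | d'.+1 => fun c c' => face_coef (val c) (val c')
  end.

Definition boundary (d : nat) (x : chain d.+1) : chain d :=
  [ffun c' => \sum_c x c * boundary_entry c c'].

(* H_0 = S / E: the image of F_1 -> F_0 = S is the edge ideal.
   H_{d+1} = 0 for all d: kernel and image agree (which includes the
   fact that two consecutive boundaries compose to 0). *)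
Definition is_resolution : Prop :=
  (forall p : S, (exists x : chain 1, boundary x = [ffun=> p]) <-> edge_ideal p)
  /\ (forall (d : nat) (z : chain d.+1),
        boundary z = 0 <-> exists y : chain d.+2, boundary y = z).

Definition is_minimal : Prop :=
  forall (d : nat) (c : basis d.+1) (c' : basis d),
    in_ideal (fun i : 'I_(m + n) => 'X_i : S) (boundary_entry c c').

Definition visscher_resolution : Prop := is_resolution /\ is_minimal.

End Visscher.

(* Visscher's construction for K_{m,n}^w - v; lift i : 'I_m.-1 -> 'I_m is the
   increasing map skipping i. *)
Definition visscher_resolution_del (k : fieldType) (m n : nat)
    (w : 'I_m -> 'I_n -> nat) (v : vertex m n) : Prop :=
  match v with
  | inl i => visscher_resolution k (fun a b => w (lift i a) b)
  | inr j => visscher_resolution k (fun a b => w a (lift j b))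
  end.

(* Main.v *)
Require Import Defs.
From mathcomp Require Import all_boot all_order all_algebra.
From mathcomp Require Import ring.

Set Implicit Arguments.
Unset Strict Implicit.
Unset Printing Implicit Defensive.

Import GRing.Theory.
Local Open Scope ring_scope.

(** Visscher's complex is graded by the exponent vectors [u] of monomials. The
    monomial multiple of [[A, B]] of multidegree [u] exists exactly when the
    label of [(A, B)] divides [X^u], that is, when every edge between [A] and
    [B] lies in the graph [G_u] of those [(a, b)] with [w a b <= u_a] and
    [w a b <= u_b]. So the strand of degree [u] is the cellular chain complex
    over the field of the complex of complete bipartite subgraphs (bicliques) of
    [G_u], and the complex is a resolution if and only if all these biclique
    complexes, for all vertex thresholds, are acyclic ([is_resolutionP]).
    Minimality is automatic because the weights are positive
    ([visscher_minimal]): deleting [a] from [A] lowers the exponent of [X_a] in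
    the label from a positive number to 0.

    What remains is about graphs. Isolated vertices do not matter
    ([acyclic_isolated]), and a vertex [v] adjacent to all non-isolated vertices
    of the other side makes the biclique complex acyclic ([acyclic_dominating]):
    the cone [A |-> v |: A] contracts it onto the simplex of neighbours of [v].

    If all edges at [v] have the minimal weight [alpha], then [v] is isolated in
    [G_u] when [u_v < alpha], and [G_u] has the same biclique complex as the
    corresponding graph without [v]; when [alpha <= u_v], every non-isolated
    vertex [b] of the other side has [alpha <= u_b], so [v] dominates. If one
    side has a single vertex, that vertex dominates in every [G_u].

    Conversely, setting [u_v = 0] shows that deleting any vertex preserves
    acyclicity. Take an edge [X_i Y_j] of weight [alpha]. If neither [X_i] nor
    [Y_j] had constant weight [alpha], there would be [i'] and [j'] with
    [w i' j > alpha] and [w i j' > alpha]. With thresholds [alpha] on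
    [X_i, Y_j], [w i' j'] on [X_i', Y_j'], and 0 elsewhere, the graph [G_u]
    consists of the two disjoint edges [X_i Y_j] and [X_i' Y_j'], whose biclique
    complex is disconnected ([min_edge_dominated]). *)

(** * Chains on a simplex *)

Section Simplex.

Variables (k : comNzRingType) (N : nat).
Implicit Types (A : {set 'I_N}) (f : {set 'I_N} -> k).

(** Signs of different faces are compared through this shift of positions. *)
Lemma rank_in_setU1 A (a b : 'I_N) :
  a \notin A -> rank_in (a |: A) b = (rank_in A b + (a < b))%N.
Proof.
move=> aA; rewrite /rank_in; case: (ltnP a b) => ab.
  rewrite (_ : [set x in a |: A | _] = a |: [set x in A | (x < b)%N]).
    by rewrite cardsU1 inE (negbTE aA) addnC.
  by apply/setP=> x; rewrite !inE; case: eqP => // ->.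
rewrite addn0; congr #|pred_of_set _|; apply/setP=> x; rewrite !inE.
by case: eqP => //= ->; rewrite (negbTE aA) ltnNge ab.
Qed.

Lemma rank_in_setU1_self A (a : 'I_N) : rank_in (a |: A) a = rank_in A a.
Proof.
rewrite /rank_in; congr #|pred_of_set _|; apply/setP => x; rewrite !inE.
by case: eqP => //= ->; rewrite ltnn andbF.
Qed.

(** Chains are stored as their coefficient functions on all vertex sets, so the
    boundary collects the coefficients of the cofaces [a |: A]. The empty set is
    not special here: this is the augmented complex of the full simplex. *)
Definition simplex_bd f A : k :=
  \sum_(a | a \notin A) (-1) ^+ rank_in A a * f (a |: A).

Lemma eq_simplex_bd f g A :
  (forall a, a \notin A -> f (a |: A) = g (a |: A)) ->
  simplex_bd f A = simplex_bd g A.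
Proof. by move=> fg; apply: eq_bigr => a aA; rewrite fg. Qed.

Lemma simplex_bd0 f A : (forall a, a \notin A -> f (a |: A) = 0) -> simplex_bd f A = 0.
Proof. by move=> f0; rewrite /simplex_bd big1 // => a /f0->; rewrite mulr0. Qed.

Lemma simplex_bdD f g A :
  simplex_bd (fun B => f B + g B) A = simplex_bd f A + simplex_bd g A.
Proof. by rewrite -big_split; apply: eq_bigr => a _; rewrite mulrDr. Qed.

Lemma simplex_bdZ c f A :
  simplex_bd (fun B => c * f B) A = c * simplex_bd f A.
Proof. by rewrite mulr_sumr; apply: eq_bigr => a _; rewrite mulrCA. Qed.

Lemma simplex_bdN f A : simplex_bd (fun B => - f B) A = - simplex_bd f A.
Proof. by rewrite -sumrN; apply: eq_bigr => a _; rewrite mulrN. Qed.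

Lemma simplex_bd_sign f A :
  simplex_bd (fun B => (-1) ^+ #|B| * f B) A = - ((-1) ^+ #|A| * simplex_bd f A).
Proof.
rewrite -mulNr -simplex_bdZ; apply: eq_simplex_bd => a aA.
by rewrite cardsU1 aA exprS mulN1r.
Qed.

Lemma simplex_bd_set0 f : simplex_bd f set0 = \sum_a f [set a].
Proof.
apply: eq_big => [a|a _]; first by rewrite inE.
rewrite setU0 (_ : rank_in _ _ = 0%N) ?mul1r //.
by apply/eqP; rewrite cards_eq0; apply/eqP/setP=> x; rewrite !inE.
Qed.

(** Removing [a] then [b] and removing [b] then [a] give opposite signs. The
    terms are cancelled in pairs [a < b], [b < a], which works in every
    characteristic. *)
Lemma simplex_bd_bd f A : simplex_bd (simplex_bd f) A = 0.
Proof.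
rewrite /simplex_bd.
pose F a b := (-1) ^+ rank_in A a * ((-1) ^+ rank_in (a |: A) b * f (b |: (a |: A))).
have FN a b : a \notin A -> b \notin A -> (a < b)%N -> F a b = - F b a.
  move=> aA bA ab; rewrite /F !rank_in_setU1 // ab ltnNge ltnW //= addn0 addn1.
  by rewrite setUCA exprS; ring.
transitivity (\sum_(a | a \notin A) \sum_(b | b \notin a |: A) F a b).
  by apply: eq_bigr => a _; rewrite mulr_sumr.
pose P (r : rel 'I_N) := \sum_(a | a \notin A) \sum_(b | (b \notin A) && r a b) F a b.
have -> : \sum_(a | a \notin A) \sum_(b | b \notin a |: A) F a b =
   P (fun a b => (a < b)%N) + P (fun a b => (b < a)%N).
  rewrite -big_split; apply: eq_bigr => a aA /=.
  rewrite (bigID (fun b : 'I_N => (a < b)%N)) /=; congr (_ + _); apply: eq_bigl => b;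
    rewrite !inE; case: (ltngtP a b) => [ab|ab|/val_inj ->]; rewrite ?eqxx ?andbF //=.
  - by rewrite !andbT; case: eqP ab => // ->; rewrite ltnn.
  - by rewrite !andbT; case: eqP ab => // ->; rewrite ltnn.
rewrite [X in X + _](_ : _ = - P (fun a b => (b < a)%N)) ?addNr //.
rewrite /P -sumrN.
under [RHS]eq_bigr do rewrite -sumrN.
rewrite (exchange_big_dep (fun b => b \notin A)) /=; last by move=> a b _ /andP[].
apply: eq_bigr => a aA; apply: eq_big => [b|b /andP[bA /andP[_ ab]]].
  by rewrite aA.
exact: FN.
Qed.

(** The coefficient function of the chain map sending [[A]] to the oriented
    simplex [[v, A]], and to 0 if [v] already lies in [A]. *)
Definition cone (v : 'I_N) f A : k :=
  if v \in A then (-1) ^+ rank_in A v * f (A :\ v) else 0.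

(** Coning off and taking boundaries anticommute up to the identity: a term
    where the vertex [a] is removed from [[v, A]] cancels unless [a] is [v]
    itself. As the empty set is a face, the identity holds without correction
    terms. *)
Lemma cone_homotopy v f A :
  simplex_bd (cone v f) A + cone v (simplex_bd f) A = f A.
Proof.
rewrite {2}/cone; case: ifPn => vA; last first.
  rewrite addr0 /simplex_bd (bigD1 v) //= big1 ?addr0; last first.
    by move=> a /andP[aA av]; rewrite /cone !inE eq_sym (negbTE av) (negbTE vA) mulr0.
  by rewrite /cone setU11 rank_in_setU1_self setU1K // signrMK.
have [B vB ->] : exists2 B : {set _}, v \notin B & A = v |: B.
  by exists (A :\ v); rewrite ?setD11 ?setD1K.
rewrite setU1K // rank_in_setU1_self {2}/simplex_bd (bigD1 v) //= mulrDr signrMK.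
rewrite addrCA -[RHS]addr0; congr (_ + _).
rewrite mulr_sumr (eq_bigl (fun a => a \notin v |: B)) => [|a]; last first.
  by rewrite !inE negb_or andbC.
rewrite -big_split big1 //= => a; rewrite !inE negb_or => /andP[av aB].
rewrite /cone !inE eqxx orbT rank_in_setU1 // setUCA rank_in_setU1_self setU1K;
  last first.
  by rewrite !inE negb_or eq_sym av.
rewrite (rank_in_setU1 _ aB) !exprD.
have -> : (-1) ^+ (v < a)%N = - (-1) ^+ (a < v)%N :> k.
  by case: (ltngtP a v) av => [||/val_inj->]; rewrite ?eqxx ?expr0 ?expr1 ?opprK.
by case: (a < v)%N; rewrite ?expr0 ?expr1; ring.
Qed.

End Simplex.

Section SimplexLift.

Variables (k : comNzRingType) (N : nat) (i : 'I_N).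

Lemma lift_mem (A : {set 'I_N.-1}) a : (lift i a \in lift i @: A) = (a \in A).
Proof. by rewrite mem_imset //; apply: lift_inj. Qed.

Lemma notin_lift (A : {set 'I_N.-1}) : i \notin lift i @: A.
Proof. by apply/imsetP=> -[a _ /eqP]; rewrite (negbTE (neq_lift _ _)). Qed.

Lemma rank_in_lift (A : {set 'I_N.-1}) a :
  rank_in (lift i @: A) (lift i a) = rank_in A a.
Proof.
rewrite /rank_in -(card_imset _ (@lift_inj _ i)).
congr #|pred_of_set _|; apply/setP=> x; rewrite !inE.
have lt_lift b : (lift i b < lift i a)%N = (b < a)%N.
  by rewrite !ltnNge /= leq_bump2.
case: (unliftP i x) => [b|] ->; first by rewrite !lift_mem inE lt_lift.
rewrite (negbTE (notin_lift _)); apply/esym/negbTE.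
by apply/imsetP=> -[b _ /eqP]; rewrite (negbTE (neq_lift _ _)).
Qed.

(** Since [lift i] is increasing, it preserves positions, hence signs; the extra
    coface through [i] is excluded by the hypothesis. *)
Lemma simplex_bd_lift (f : {set 'I_N} -> k) (A : {set 'I_N.-1}) :
  f (i |: lift i @: A) = 0 ->
  simplex_bd f (lift i @: A) =
  simplex_bd (fun A' : {set 'I_N.-1} => f (lift i @: A')) A.
Proof.
move=> fi; rewrite /simplex_bd (bigD1 i) ?notin_lift //= fi mulr0 add0r.
rewrite (reindex_omap (lift i) (unlift i)) /=; last first.
  by move=> x /andP[_ xi]; case: (unliftP i x) xi => [j ->|->] //; rewrite eqxx.
apply: eq_big => [a|a _].
  by rewrite lift_mem liftK eqxx eq_sym neq_lift !andbT.
by rewrite rank_in_lift imsetU1.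
Qed.

End SimplexLift.

(** * Chains on products of simplices *)

Section Bichain.

Variables (k : comNzRingType) (m n : nat).
Implicit Types (y z : {set 'I_m} -> {set 'I_n} -> k) (A : {set 'I_m}) (B : {set 'I_n}).

(** The total boundary of a tensor product. On sets [A] and [B] that are both
    nonempty it is the boundary of the product of two unaugmented simplices;
    values where one of them is empty carry no meaning. *)
Definition biclique_bd y A B : k :=
  simplex_bd (y^~ B) A + (-1) ^+ #|A| * simplex_bd (y A) B.

Definition augmentation y : k := \sum_a \sum_b y [set a] [set b].

(** Cycles in every positive homological degree at once: the augmentation is the
    map to degree 0, the boundary condition covers the others. *)
Definition biclique_cycle y : Prop :=
  (forall A B, A != set0 -> B != set0 -> biclique_bd y A B = 0) /\ augmentation y = 0.

Lemma simplex_bd_exchange y A B :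
  simplex_bd (fun A' => simplex_bd (y A') B) A =
  simplex_bd (fun B' => simplex_bd (y^~ B') A) B.
Proof.
rewrite /simplex_bd; under eq_bigr do rewrite mulr_sumr.
rewrite exchange_big; apply: eq_bigr => b _; rewrite mulr_sumr.
by apply: eq_bigr => a _; rewrite mulrCA.
Qed.

(** The two unaugmented boundaries, continued to the empty sets, compose to the
    augmentation. This lets the identities for [simplex_bd] apply to it too. *)
Lemma augmentationE y :
  augmentation y = simplex_bd (fun A => simplex_bd (y A) set0) set0.
Proof.
by rewrite simplex_bd_set0; apply: eq_bigr => a _; rewrite simplex_bd_set0.
Qed.

Lemma eq_biclique_bd y z A B :
  A != set0 -> B != set0 ->
  (forall A B, A != set0 -> B != set0 -> y A B = z A B) ->
  biclique_bd y A B = biclique_bd z A B.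
Proof.
move=> A0 B0 yz; congr (_ + _ * _); apply: eq_simplex_bd => x _; rewrite yz //;
  by apply/set0Pn; exists x; rewrite setU11.
Qed.

Lemma eq_biclique_cycle y z :
  (forall A B, A != set0 -> B != set0 -> y A B = z A B) ->
  biclique_cycle y -> biclique_cycle z.
Proof.
move=> yz [dy ey]; split=> [A B A0 B0|].
  by rewrite -(eq_biclique_bd A0 B0 yz) dy.
rewrite -[RHS]ey; apply: eq_bigr => a _; apply: eq_bigr => b _.
by rewrite yz // -cards_eq0 cards1.
Qed.

Lemma biclique_bdD y z A B :
  biclique_bd (fun A B => y A B + z A B) A B = biclique_bd y A B + biclique_bd z A B.
Proof. by rewrite /biclique_bd !simplex_bdD mulrDr addrACA. Qed.

Lemma biclique_bdN y A B :
  biclique_bd (fun A B => - y A B) A B = - biclique_bd y A B.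
Proof. by rewrite /biclique_bd !simplex_bdN mulrN opprD. Qed.

(** The two boundaries commute, and the sign [(-1) ^+ #|A|] turns this into
    anticommutation. For the augmentation, the two terms vanish separately
    because each contains a repeated simplex boundary. *)
Lemma biclique_bd_is_cycle y : biclique_cycle (biclique_bd y).
Proof.
split=> [A B _ _|].
  rewrite /biclique_bd simplex_bdD simplex_bd_bd add0r.
  rewrite (simplex_bd_sign (fun A' => simplex_bd (y A') B)).
  by rewrite simplex_bdD simplex_bdZ simplex_bd_bd mulr0 addr0
    simplex_bd_exchange addNr.
rewrite /augmentation (eq_bigr (fun a =>
    simplex_bd (fun B => simplex_bd (y^~ B) [set a]) set0
    - simplex_bd (simplex_bd (y [set a])) set0)) => [|a _]; last first.
  rewrite -simplex_bdN -simplex_bdD simplex_bd_set0; apply: eq_bigr => b _.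
  by rewrite /biclique_bd cards1 expr1 mulN1r.
under eq_bigr do rewrite simplex_bd_bd subr0.
rewrite -(simplex_bd_set0 (fun A => simplex_bd (fun B => simplex_bd (y^~ B) A) set0)).
rewrite (simplex_bd_exchange (fun A B => simplex_bd (y^~ B) A)).
by apply: simplex_bd0 => b _; apply: simplex_bd_bd.
Qed.

End Bichain.

(** * Biclique complexes, and graphs with a dominating vertex *)

Section Biclique.

Variables (m n : nat).
Implicit Types (G : 'I_m -> 'I_n -> bool) (A : {set 'I_m}) (B : {set 'I_n}).

Definition biclique G A B : bool :=
  [&& A != set0, B != set0 & [forall a in A, forall b in B, G a b]].

Lemma bicliqueP G A B :
  reflect [/\ A != set0, B != set0 & {in A & B, forall a b, G a b}] (biclique G A B).
Proof.
apply: (iffP and3P) => -[A0 B0 AB]; split=> //.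
  by move=> a b aA bB; move/forall_inP/(_ a aA)/forall_inP: AB; apply.
by apply/forall_inP => a aA; apply/forall_inP => b bB; apply: AB.
Qed.

Definition biclique_supported (k : nmodType) G
    (y : {set 'I_m} -> {set 'I_n} -> k) : Prop :=
  forall A B, ~~ biclique G A B -> y A B = 0.

(** Exactness in positive homological degrees of the augmented biclique complex.
    Cycles are taken homogeneous of total size [d]; the bounding chain need not
    be, since its other components do not affect the boundary in size [d]. *)
Definition acyclic (k : comNzRingType) G : Prop :=
  forall d (z : {set 'I_m} -> {set 'I_n} -> k),
    biclique_supported G z -> (forall A B, (#|A| + #|B|)%N != d -> z A B = 0) ->
    biclique_cycle z ->
  exists2 y, biclique_supported G y &
    forall A B, A != set0 -> B != set0 -> biclique_bd y A B = z A B.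

Lemma biclique_sub G A B A' B' :
  biclique G A B -> A' \subset A -> B' \subset B -> A' != set0 -> B' != set0 ->
  biclique G A' B'.
Proof.
move=> /bicliqueP[_ _ AB] sA sB A0 B0; apply/bicliqueP; split=> // a b aA bB.
by apply: AB; [apply: (subsetP sA)|apply: (subsetP sB)].
Qed.

Lemma eq_biclique G G' A B : G =2 G' -> biclique G A B = biclique G' A B.
Proof.
move=> GG; apply/bicliqueP/bicliqueP => -[? ? AB]; split=> // a b aA bB.
  by rewrite -GG AB.
by rewrite GG AB.
Qed.

Lemma eq_acyclic k G G' : G =2 G' -> acyclic k G -> acyclic k G'.
Proof.
move=> GG acG d z zs zd zc.
have zs' : biclique_supported G z.
  by move=> A B AB; apply: zs; rewrite -(eq_biclique _ _ GG).
have [y ys dy] := acG d z zs' zd zc.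
by exists y => // A B AB; apply: ys; rewrite (eq_biclique _ _ GG).
Qed.

(** Subsets of bicliques are bicliques. *)
Lemma biclique_bd_supported (k : comNzRingType) G
    (y : {set 'I_m} -> {set 'I_n} -> k) A B :
  biclique_supported G y -> A != set0 -> B != set0 -> ~~ biclique G A B ->
  biclique_bd y A B = 0.
Proof.
move=> ys A0 B0 AB; rewrite /biclique_bd !simplex_bd0 ?mulr0 ?addr0 // => x _;
  apply: ys; apply: contra AB => /biclique_sub; apply=> //; exact: subsetUr.
Qed.

(** Coning with [v] contracts the complex up to an error concentrated on
    [A = {v}]: there the cone formula would need the missing face
    [A :\ v = set0]. The error is a cycle on the simplex of neighbours of [v],
    and a second cone, with one such neighbour [b0], bounds it. *)
Lemma acyclic_dominating (k : comNzRingType) G v :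
  (forall a b, G a b -> G v b) -> acyclic k G.
Proof.
move=> vdom d z zs _ [zc za].
have z0l B : z set0 B = 0 by apply: zs; rewrite /biclique eqxx.
(* If [v] has no neighbours, the graph has no edges and [z] is zero. *)
have [b0 vb0|noN] := pickP (G v); last first.
  exists (fun _ _ => 0) => // A B _ _; rewrite /biclique_bd !simplex_bd0 // mulr0 addr0.
  apply/esym/zs; apply/bicliqueP => -[/set0Pn[a aA] /set0Pn[b bB] /(_ a b aA bB) /vdom].
  by rewrite noN.
(* Up to sign, [g] is the error of the first cone [y1]; [y2] bounds it. *)
pose g B := simplex_bd (z^~ B) set0.
pose y1 A B := cone v (z^~ B) A.
pose y2 A B := if A == [set v] then cone b0 g B else 0.
have hdg B : B != set0 -> simplex_bd (cone b0 g) B = g B.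
  move=> B0; rewrite -[RHS](cone_homotopy b0) /cone; case: ifP => bB;
    last by rewrite addr0.
  suff -> : simplex_bd g (B :\ b0) = 0 by rewrite mulr0 addr0.
  rewrite /g -simplex_bd_exchange; have [->|B1] := eqVneq (B :\ b0) set0.
    by rewrite -augmentationE.
  rewrite -[RHS](simplex_bd_bd (z^~ (B :\ b0)) set0); apply: eq_simplex_bd => a _.
  rewrite setU0; have := zc [set a] _ _ B1; rewrite -cards_eq0 cards1 => /(_ isT).
  by rewrite /biclique_bd cards1 expr1 mulN1r => /subr0_eq.
have dy1 : forall A B, A != set0 -> B != set0 ->
    biclique_bd y1 A B = z A B - if A == [set v] then g B else 0.
  move=> A B A0 B0; rewrite -[z A B](cone_homotopy v (z^~ B)) -/(y1^~ B).
  rewrite /biclique_bd -addrA; congr (_ + _); rewrite /y1 /cone.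
  case: ifPn => [vA|vA]; last first.
    rewrite simplex_bd0 ?mulr0 // add0r; case: eqP vA => [->|]; rewrite ?oppr0 //.
    by rewrite set11.
  rewrite simplex_bdZ mulrCA -(setD1K vA) cardsU1 setD11 setD1K // exprS mulN1r.
  have [AE|A1] := eqVneq (A :\ v) set0.
    have -> : A = [set v] by rewrite -(setD1K vA) AE setU0.
    rewrite eqxx setDv simplex_bd0 => [|b _]; last exact: z0l.
    rewrite !mulr0 (_ : rank_in _ _ = 0%N) ?mul1r ?subrr //.
    by apply/eqP; rewrite cards_eq0; apply/eqP/setP=> x; rewrite !inE;
      case: eqP => //= ->; rewrite ltnn.
  rewrite ifN; last by apply: contraNneq A1 => ->; rewrite setDv.
  have /eqP := zc _ _ A1 B0; rewrite /biclique_bd addr_eq0 => /eqP->; ring.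
have dy2 : forall A B, A != set0 -> B != set0 ->
    biclique_bd y2 A B = - if A == [set v] then g B else 0.
  move=> A B A0 B0; rewrite /biclique_bd simplex_bd0 ?add0r => [|a aA].
    rewrite /y2; case: eqP => [->|_]; last by rewrite simplex_bd0 ?mulr0 ?oppr0.
    by rewrite hdg // cards1 mulN1r.
  rewrite /y2 ifN //; apply: contraNneq A0 => Aa.
  have := subsetUr [set a] A; rewrite Aa; rewrite subset1 => /orP[/eqP Av|//].
  by move: aA; rewrite Av -Aa setU11.
exists (fun A B => y1 A B - y2 A B) => [A B AB|A B A0 B0].
  have y1E : y1 A B = 0.
    rewrite /y1 /cone; case: ifP => // vA; rewrite zs ?mulr0 //.
    apply: contra AB => /bicliqueP[A0 B0 AB]; apply/bicliqueP; split=> //.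
      by apply/set0Pn; exists v.
    move=> a b aA bB; have [->|av] := eqVneq a v.
      by case/set0Pn: A0 => c cA; apply: vdom (AB c b cA bB).
    by apply: AB; rewrite // !inE av.
  rewrite y1E sub0r /y2; case: eqP => [Av|]; last by rewrite oppr0.
  rewrite /cone; case: ifP => bB; last by rewrite oppr0.
  rewrite /g simplex_bd0 ?mulr0 ?oppr0 // => a _; apply: zs.
  apply: contra AB => /bicliqueP[A0 B0 AB]; apply/bicliqueP; split.
  - by rewrite Av -cards_eq0 cards1.
  - by apply/set0Pn; exists b0.
  - move=> v' b; rewrite Av inE => /eqP-> bB'; have [->//|bb] := eqVneq b b0.
    by apply: (vdom a); apply: AB; rewrite !inE ?eqxx // bb.
by rewrite biclique_bdD biclique_bdN dy1 // dy2 // opprK subrK.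
Qed.

End Biclique.

(** * Deleting an isolated vertex *)

Section IsolatedVertex.

Variables (k : comNzRingType) (m n : nat) (G : 'I_m -> 'I_n -> bool) (i : 'I_m).
Hypothesis isolated_i : forall b, ~~ G i b.
Implicit Types (A : {set 'I_m}) (B : {set 'I_n}).

Let G' a b := G (lift i a) b.

Lemma biclique_isolated (A : {set 'I_m}) B : i \in A -> ~~ biclique G A B.
Proof.
move=> iA; apply/bicliqueP => -[_ /set0Pn[b bB] /(_ i b iA bB)].
by rewrite (negbTE (isolated_i b)).
Qed.

Lemma lift_preimset (A : {set 'I_m}) : i \notin A -> lift i @: (lift i @^-1: A) = A.
Proof.
move=> iA; apply/setP=> x; case: (unliftP i x) => [a|] ->.
  by rewrite lift_mem inE.
by rewrite (negbTE iA) (negbTE (notin_lift _ _)).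
Qed.

Lemma lift_imset_eq0 (A : {set 'I_m.-1}) : (lift i @: A == set0) = (A == set0).
Proof. by rewrite -!cards_eq0 (card_imset _ lift_inj). Qed.

Lemma biclique_lift (A : {set 'I_m.-1}) B :
  biclique G (lift i @: A) B = biclique G' A B.
Proof.
apply/bicliqueP/bicliqueP; rewrite lift_imset_eq0 => -[A0 B0 AB]; split=> //.
  by move=> a b aA bB; apply: AB; rewrite ?lift_mem.
by move=> _ b /imsetP[a aA ->] bB; apply: AB.
Qed.

Section Transport.

Variable y : {set 'I_m} -> {set 'I_n} -> k.
Hypothesis y_i : forall A B, i \in A -> y A B = 0.

Let y' (A : {set 'I_m.-1}) B := y (lift i @: A) B.

Lemma biclique_bd_lift (A : {set 'I_m.-1}) B :
  biclique_bd y (lift i @: A) B = biclique_bd y' A B.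
Proof.
by rewrite /biclique_bd simplex_bd_lift ?(card_imset _ lift_inj) // y_i ?setU11.
Qed.

Lemma biclique_cycle_lift : biclique_cycle y <-> biclique_cycle y'.
Proof.
have ey : augmentation y = augmentation y'.
  rewrite !augmentationE -(imset0 (lift i)) simplex_bd_lift // imset0.
  by apply: simplex_bd0 => b _; rewrite y_i ?setU11.
rewrite /biclique_cycle ey; split=> -[dy ay]; split=> // A B A0 B0.
  by rewrite -biclique_bd_lift dy // lift_imset_eq0.
have [iA|iA] := boolP (i \in A); last first.
  by rewrite -(lift_preimset iA) biclique_bd_lift dy // -lift_imset_eq0 lift_preimset.
rewrite /biclique_bd !simplex_bd0 ?mulr0 ?addr0 // => x _; apply: y_i => //.
by rewrite !inE iA orbT.
Qed.

End Transport.

Definition extend_by0 (y' : {set 'I_m.-1} -> {set 'I_n} -> k) (A : {set 'I_m}) B :=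
  if i \in A then 0 else y' (lift i @^-1: A) B.

Lemma extend_by0_lift y' (A : {set 'I_m.-1}) B : extend_by0 y' (lift i @: A) B = y' A B.
Proof.
rewrite /extend_by0 (negbTE (notin_lift _ _)); congr (y' _ B).
by apply/setP=> a; rewrite inE lift_mem.
Qed.

Lemma extend_by0_isolated y' (A : {set 'I_m}) B : i \in A -> extend_by0 y' A B = 0.
Proof. by rewrite /extend_by0 => ->. Qed.

Lemma extend_by0_supported y' : biclique_supported G' y' ->
  biclique_supported G (extend_by0 y').
Proof.
move=> ys A B; rewrite /extend_by0; case: ifPn => // iA AB; apply: ys.
by rewrite -biclique_lift lift_preimset.
Qed.

(** No biclique contains an isolated vertex, so both complexes have the same
    cells; chains are carried along [lift i] by restriction and extension by
    zero. *)
Lemma acyclic_isolated : acyclic k G <-> acyclic k G'.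
Proof.
split=> acG d z zs zd zc.
  pose z1 := extend_by0 z.
  have z1i := @extend_by0_isolated z.
  have z1d A B : (#|A| + #|B|)%N != d -> z1 A B = 0.
    rewrite /z1 /extend_by0; case: ifPn => // iA; rewrite -{1}(lift_preimset iA).
    by rewrite (card_imset _ lift_inj) => /zd.
  have z1c : biclique_cycle z1.
    apply/(biclique_cycle_lift z1i); apply: eq_biclique_cycle zc => A B _ _.
    by rewrite extend_by0_lift.
  have [y ys dy] := acG d z1 (extend_by0_supported zs) z1d z1c.
  exists (fun (A : {set 'I_m.-1}) B => y (lift i @: A) B) => [A B AB|A B A0 B0].
    by rewrite ys // biclique_lift.
  rewrite -biclique_bd_lift => [|A' B' iA]; last by rewrite ys ?biclique_isolated.
  by rewrite dy ?lift_imset_eq0 // /z1 extend_by0_lift.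
have zi A B : i \in A -> z A B = 0 by move=> iA; rewrite zs ?biclique_isolated.
have zs' : biclique_supported G' (fun (A : {set 'I_m.-1}) B => z (lift i @: A) B).
  by move=> A B AB; rewrite zs // biclique_lift.
have zd' (A : {set 'I_m.-1}) B : (#|A| + #|B|)%N != d -> z (lift i @: A) B = 0.
  by move=> AB; rewrite zd // (card_imset _ lift_inj).
have [y ys dy] := acG d _ zs' zd' ((biclique_cycle_lift zi).1 zc).
have ys1 := extend_by0_supported ys.
exists (extend_by0 y) => // A B A0 B0.
have [iA|iA] := boolP (i \in A).
  by rewrite zi // (biclique_bd_supported ys1) // biclique_isolated.
have A0' : lift i @^-1: A != set0 by rewrite -lift_imset_eq0 lift_preimset.
rewrite -(lift_preimset iA) -(dy _ _ A0' B0) biclique_bd_lift; last first.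
  exact: extend_by0_isolated.
by apply: eq_biclique_bd => // A' B' _ _; rewrite extend_by0_lift.
Qed.

End IsolatedVertex.

(** * Exchanging the two sides *)

Section Transpose.

Variable k : comNzRingType.

(** The sign makes the swap of tensor factors a chain map. *)
Definition bitranspose m n (y : {set 'I_m} -> {set 'I_n} -> k)
    (B : {set 'I_n}) (A : {set 'I_m}) : k :=
  (-1) ^+ (#|A| * #|B|) * y A B.

Lemma bitransposeK m n (y : {set 'I_m} -> {set 'I_n} -> k)
    (A : {set 'I_m}) (B : {set 'I_n}) :
  bitranspose (bitranspose y) A B = y A B.
Proof. by rewrite /bitranspose mulnC signrMK. Qed.

Lemma biclique_bd_transpose m n (y : {set 'I_m} -> {set 'I_n} -> k)
    (A : {set 'I_m}) (B : {set 'I_n}) :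
  biclique_bd (bitranspose y) B A = bitranspose (biclique_bd y) B A.
Proof.
have cardU N (x : 'I_N) (C : {set 'I_N}) : x \notin C -> #|x |: C| = #|C|.+1.
  by move=> xC; rewrite cardsU1 xC.
rewrite /bitranspose /biclique_bd mulrDr addrC; congr (_ + _).
  rewrite -!simplex_bdZ; apply: eq_simplex_bd => a aA.
  by rewrite cardU // mulSn exprD -mulrA signrMK.
rewrite -!simplex_bdZ; apply: eq_simplex_bd => b bB.
by rewrite cardU // mulnS exprD; ring.
Qed.

(** On the augmentation the sign is that of a pair of vertices, namely -1. *)
Lemma biclique_cycle_transpose m n (y : {set 'I_m} -> {set 'I_n} -> k) :
  biclique_cycle y -> biclique_cycle (bitranspose y).
Proof.
move=> [dy ay]; split=> [B A B0 A0|].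
  by rewrite biclique_bd_transpose /bitranspose dy // mulr0.
rewrite /augmentation exchange_big; apply/eqP; rewrite -oppr_eq0 -[X in _ == X]ay.
apply/eqP; rewrite -sumrN; apply: eq_bigr => a _; rewrite -sumrN.
by apply: eq_bigr => b _; rewrite /bitranspose !cards1 mulN1r opprK.
Qed.

Lemma biclique_transpose m n (G : 'I_m -> 'I_n -> bool)
    (A : {set 'I_m}) (B : {set 'I_n}) :
  biclique (fun b a => G a b) B A = biclique G A B.
Proof. by apply/bicliqueP/bicliqueP => -[? ? AB]; split=> // x x' ? ?; apply: AB. Qed.

Lemma bitranspose_supported m n (G : 'I_m -> 'I_n -> bool)
    (y : {set 'I_m} -> {set 'I_n} -> k) :
  biclique_supported G y -> biclique_supported (fun b a => G a b) (bitranspose y).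
Proof.
by move=> ys B A; rewrite biclique_transpose /bitranspose => /ys->; rewrite mulr0.
Qed.

Lemma acyclic_transpose m n (G : 'I_m -> 'I_n -> bool) :
  acyclic k G -> acyclic k (fun b a => G a b).
Proof.
move=> acG d z zs zd zc.
have zd' (A : {set 'I_m}) (B : {set 'I_n}) :
    (#|A| + #|B|)%N != d -> bitranspose z A B = 0.
  by rewrite addnC /bitranspose => /zd->; rewrite mulr0.
have [y ys dy] := acG d _ (bitranspose_supported zs) zd' (biclique_cycle_transpose zc).
exists (bitranspose y); first exact: bitranspose_supported.
by move=> B A B0 A0; rewrite biclique_bd_transpose -[RHS]bitransposeK /bitranspose dy.
Qed.

(** If the edge [ij] is a connected component and there is an edge elsewhere,
    the difference of these two edges is a cycle. It does not bound: the vertex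
    [(i, j)] of the biclique complex lies in no larger biclique, so every
    boundary vanishes there. *)
Lemma isolated_edge_not_acyclic m n (G : 'I_m -> 'I_n -> bool) i j i' j' :
  (forall b, G i b = (b == j)) -> (forall a, G a j = (a == i)) ->
  G i' j' -> i' != i -> ~ acyclic k G.
Proof.
move=> Gi Gj Gij ii acG.
have Gi1 : G i j by rewrite Gi.
pose e a b (A : {set 'I_m}) (B : {set 'I_n}) : k :=
  ((A == [set a]) && (B == [set b]))%:R.
pose z A B := e i j A B - e i' j' A B.
have one_biclique a b : G a b -> biclique G [set a] [set b].
  move=> ab; apply/bicliqueP; rewrite -!cards_eq0 !cards1; split=> //.
  by move=> x y; rewrite !inE => /eqP-> /eqP->.
have es a b : G a b -> biclique_supported G (e a b).
  move=> ab A B AB; rewrite /e; case: andP => // -[/eqP AE /eqP BE].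
  by rewrite AE BE one_biclique in AB.
have zs : biclique_supported G z by move=> A B AB; rewrite /z !es ?subrr.
have ed a b (A : {set 'I_m}) (B : {set 'I_n}) : (#|A| + #|B|)%N != 2%N -> e a b A B = 0.
  by rewrite /e; case: andP => // -[/eqP-> /eqP->]; rewrite !cards1.
have zd (A : {set 'I_m}) (B : {set 'I_n}) : (#|A| + #|B|)%N != 2%N -> z A B = 0.
  by move=> AB; rewrite /z !ed ?subrr.
have dz0 (A : {set 'I_m}) (B : {set 'I_n}) : A != set0 -> B != set0 ->
  biclique_bd z A B = 0.
  rewrite -!card_gt0 => A0 B0.
  rewrite /biclique_bd !simplex_bd0 ?mulr0 ?addr0 // => x xA; apply: zd;
  by rewrite cardsU1 xA; move: A0 B0; case: #|A| => // p _; case: #|B| => // q _;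
     rewrite ?addSn ?addnS.
have ez a b : augmentation (e a b) = 1.
  rewrite /augmentation (bigD1 a) //= (bigD1 b) //= /e !eqxx !big1 ?addr0 //.
    move=> a' aa; rewrite big1 // => b' _.
    by rewrite (inj_eq set1_inj) (negbTE aa).
  by move=> b' bb; rewrite (inj_eq set1_inj) (negbTE bb) ?andbF.
have az : augmentation z = 0.
  transitivity (augmentation (e i j) - augmentation (e i' j'));
    last by rewrite !ez subrr.
  by rewrite /augmentation -sumrB; apply: eq_bigr => a _; rewrite -sumrB.
have [y ys /(_ [set i] [set j])] := acG 2%N z zs zd (conj dz0 az).
rewrite -!cards_eq0 !cards1 => /(_ isT isT) /eqP.
rewrite /biclique_bd !simplex_bd0 ?mulr0 ?addr0; last 2 first.
- move=> b; rewrite inE => bj; apply: ys; apply/bicliqueP => -[_ _ /(_ i b)].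
  by rewrite set11 setU11 Gi (negbTE bj) => /(_ isT isT).
- move=> a; rewrite inE => ai; apply: ys; apply/bicliqueP => -[_ _ /(_ a j)].
  by rewrite set11 setU11 Gj (negbTE ai) => /(_ isT isT).
by rewrite /z /e !eqxx (inj_eq set1_inj) eq_sym [i == _]eq_sym (negbTE ii)
  subr0 oner_eq0.
Qed.

End Transpose.

(** * Multigraded strands of Visscher's complex *)

Lemma mcoeff_mulX N (R : comNzRingType) (p : {mpoly R[N]}) (e q : 'X_{1..N}) :
  (p * 'X_[e])@_q = if (e <= q)%MM then p@_(q - e) else 0.
Proof.
case: ifP => [eq|neq]; first by rewrite -{1}(submK eq) addmC mcoeffMX.
rewrite [in LHS](mpolyE p) mulr_suml raddf_sum big1 // => r _ /=.
rewrite -scalerAl -mpolyXD mcoeffZ mcoeffX; case: eqP => [re|]; last by rewrite mulr0.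
by rewrite -re lem_addl in neq.
Qed.

Lemma mcoeff_sign N (R : nzRingType) r (p : {mpoly R[N]}) (q : 'X_{1..N}) :
  ((-1) ^+ r * p)@_q = (-1) ^+ r * p@_q.
Proof. by rewrite -(rmorph_sign (@mpolyC N R)) mcoeffCM. Qed.

Lemma big_set1_support (R : Type) (idx : R) (op : Monoid.com_law idx) (T : finType)
    (f : {set T} -> R) :
  (forall A : {set T}, #|A| != 1%N -> f A = idx) ->
  \big[op/idx]_A f A = \big[op/idx]_a f [set a].
Proof.
move=> f0; rewrite (bigID (mem [set [set a] | a in setT])) /=.
rewrite [X in op _ X]big1 ?Monoid.mulm1; last first.
  move=> A nA; apply: f0; apply: contra nA => /cards1P[a ->].
  by apply/imsetP; exists a.
by rewrite big_imset => [|a b _ _ /set1_inj]; [apply: eq_bigl => a; rewrite inE|].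
Qed.

Section Strand.

Variables (k : fieldType) (m n : nat) (w : 'I_m -> 'I_n -> nat).
Implicit Types (A C : {set 'I_m}) (B D : {set 'I_n}) (u : 'X_{1..m + n}).

(** The edges surviving when the exponents of the variables are bounded by [x]
    and [y]. *)
Definition threshold (x : 'I_m -> nat) (y : 'I_n -> nat) a b : bool :=
  (w a b <= x a)%N && (w a b <= y b)%N.

Definition degree_graph u : 'I_m -> 'I_n -> bool :=
  threshold (fun a => u (lshift n a)) (fun b => u (rshift m b)).

Lemma vertex_label_le a b u : (vertex_label w a b <= u)%MM = degree_graph u a b.
Proof.
apply/mnm_lepP/andP => [lu|[wa wb] i].
  have := lu (lshift n a); have := lu (rshift m b).
  rewrite !mulmnE !mnmDE !mnm1E !eqxx eq_lrshift eq_rlshift addn0 add0n !mul1n.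
  by move=> -> ->.
rewrite mulmnE mnmDE !mnm1E; case: (split_ordP i) => j ->.
  by rewrite eq_lshift eq_rlshift addn0; case: eqP => [<-|]; rewrite ?mul1n ?mul0n.
by rewrite eq_rshift eq_lrshift add0n; case: eqP => [<-|]; rewrite ?mul1n ?mul0n.
Qed.

Lemma big_mlcm_le (T : finType) (P : {set T}) (F : T -> 'X_{1..m + n}) u :
  (\big[@mlcm (m + n)/0%MM]_(t in P) F t <= u)%MM = [forall t in P, (F t <= u)%MM].
Proof.
rewrite (@big_morph _ _ (fun e => e <= u)%MM true andb) ?big_andE // => [e e'|].
  exact: lem_mlcm.
by apply/mnm_lepP => i; rewrite mnm0E.
Qed.

(** This ties divisibility to graphs: the label of [(A, B)] divides [X^u]
    exactly when [degree_graph u] contains all edges between [A] and [B]. The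
    other facts on face labels are derived from it. *)
Lemma face_label_le A B u :
  (face_label w A B <= u)%MM = [forall a in A, forall b in B, degree_graph u a b].
Proof.
rewrite big_mlcm_le; apply: eq_forallb => a; rewrite big_mlcm_le; congr (_ ==> _).
by apply: eq_forallb => b; rewrite vertex_label_le.
Qed.

Lemma biclique_label A B u :
  biclique (degree_graph u) A B =
    [&& A != set0, B != set0 & (face_label w A B <= u)%MM].
Proof. by rewrite face_label_le. Qed.

Lemma face_labelS A A' B B' :
  A' \subset A -> B' \subset B -> (face_label w A' B' <= face_label w A B)%MM.
Proof.
move=> sA sB; have := lepm_refl (face_label w A B); rewrite !face_label_le.
move=> /forall_inP AB; apply/forall_inP => a /(subsetP sA)/AB/forall_inP aB.
by apply/forall_inP => b /(subsetP sB)/aB.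
Qed.

Lemma face_label1 a b : face_label w [set a] [set b] = vertex_label w a b.
Proof.
have E u : (face_label w [set a] [set b] <= u = (vertex_label w a b <= u))%MM.
  rewrite face_label_le vertex_label_le;
    apply/forall_inP/idP => [/(_ a (set11 a))|ab x].
    by move/forall_inP/(_ b (set11 b)).
  by rewrite inE => /eqP->; apply/forall_inP => y; rewrite inE => /eqP->.
apply/mnmP => i; apply/eqP; rewrite eqn_leq.
have := lepm_refl (face_label w [set a] [set b]); rewrite E => /mnm_lepP->.
by have := lepm_refl (vertex_label w a b); rewrite -E => /mnm_lepP->.
Qed.

Local Notation S := {mpoly k[m + n]}.

(** Chains extended by zero to all pairs of sets, so that sums over faces become
    sums over pairs. *)
Definition coef_at d (x : chain k m n d.+1) A B : S :=
  if insub (A, B) is Some c then x c else 0.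

Lemma coef_at_face d (x : chain k m n d.+1) (c : face m n d.+1) :
  coef_at x (val c).1 (val c).2 = x c.
Proof. by rewrite /coef_at -surjective_pairing valK. Qed.

Lemma coef_at0 d (x : chain k m n d.+1) A B :
  ~~ is_face d.+1 (A, B) -> coef_at x A B = 0.
Proof. by move=> nf; rewrite /coef_at insubN. Qed.

Lemma sum_faces d (x : chain k m n d.+1) (F : {set 'I_m} * {set 'I_n} -> S) :
  \sum_(c : face m n d.+1) x c * F (val c) = \sum_A \sum_B coef_at x A B * F (A, B).
Proof.
rewrite pair_bigA /= [RHS](bigID (@is_face m n d.+1)) /= [X in _ + X]big1 ?addr0.
  rewrite [RHS](eq_bigl (mem (@is_face m n d.+1))) //.
  rewrite [RHS]big_sub; apply: eq_bigr => c _.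
  by rewrite -[x c]coef_at_face -surjective_pairing.
by case=> A B nf; rewrite coef_at0 ?mul0r.
Qed.

(** The boundary matrix, indexed by faces and their facets, read from the side
    of the facet: the cofaces of [(A, B)] are [(a |: A, B)] and [(A, b |:
    B)]. *)
Lemma coef_at_boundary d (y : chain k m n d.+2) A B :
  A != set0 -> B != set0 ->
  coef_at (boundary w y) A B =
  \sum_(a | a \notin A) (-1) ^+ rank_in A a *
    (coef_at y (a |: A) B * 'X_[face_label w (a |: A) B - face_label w A B])
  + (-1) ^+ #|A| * \sum_(b | b \notin B) (-1) ^+ rank_in B b *
    (coef_at y A (b |: B) * 'X_[face_label w A (b |: B) - face_label w A B]).
Proof.
move=> A0 B0; have [f|nf] := boolP (is_face d.+1 (A, B)); last first.
  have nU C D : (#|C| + #|D|)%N = (#|A| + #|B|).+1 -> coef_at y C D = 0.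
    move=> cU; apply: coef_at0; move: nf; rewrite /is_face /= A0 B0 /= cU eqSS.
    by move=> /negbTE->; rewrite !andbF.
  rewrite coef_at0 // !big1 ?mulr0 ?addr0 // => x xA; rewrite nU ?mul0r ?mulr0 //.
    by rewrite cardsU1 xA addnS.
  by rewrite cardsU1 xA.
rewrite /coef_at insubT ffunE [LHS](sum_faces y (fun c => face_coef k w c (A, B))).
under eq_bigr do under eq_bigr do rewrite mulrDr.
under eq_bigr do rewrite big_split.
rewrite big_split pair_bigA pair_bigA /=; congr (_ + _).
  under eq_bigr do rewrite mulr_sumr.
  rewrite (exchange_big_dep xpredT) //= (bigID (mem A)) /= big1 ?add0r =>
    [|a aA]; last first.
    rewrite big_pred0 // => -[C D] /=; apply/negbTE/negP => /and3P[_ _ /eqP[AE _]].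
    by rewrite AE setD11 in aA.
  apply: eq_bigr => a aA; rewrite (big_pred1 (a |: A, B)) => [|[C D]] /=.
    by rewrite rank_in_setU1_self setU1K // mulrCA.
  apply/and3P/eqP => [[aC _ /eqP[-> ->]]|[-> ->]].
    by rewrite setD1K.
  by rewrite setU11 setU1K // cardsU1 aA ltnS card_gt0.
under eq_bigr do rewrite mulr_sumr.
rewrite (exchange_big_dep xpredT) //= (bigID (mem B)) /= big1 ?add0r =>
  [|b bB]; last first.
  rewrite big_pred0 // => -[C D] /=; apply/negbTE/negP => /and3P[_ _ /eqP[_ BE]].
  by rewrite BE setD11 in bB.
rewrite mulr_sumr; apply: eq_bigr => b bB;
  rewrite (big_pred1 (A, b |: B)) => [|[C D]] /=.
  by rewrite rank_in_setU1_self setU1K // mulrCA exprD -mulrA.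
apply/and3P/eqP => [[bD _ /eqP[-> ->]]|[-> ->]].
  by rewrite setD1K.
by rewrite setU11 setU1K // cardsU1 bB ltnS card_gt0.
Qed.

Lemma boundary1E (y : chain k m n 1) :
  boundary w y tt = \sum_a \sum_b coef_at y [set a] [set b] * 'X_[vertex_label w a b].
Proof.
rewrite ffunE (sum_faces y (fun c => 'X_[face_label w c.1 c.2])) /=.
have cy A B : (#|A| != 1%N) || (#|B| != 1%N) -> coef_at y A B = 0.
  move=> AB; apply: coef_at0; apply: contraL AB => /and3P[/=].
  rewrite -!card_gt0; case: #|A| => [|[|p]] //; case: #|B| => [|[|q]] //.
  - by rewrite addnC.
  - by move=> _ _; rewrite !addSn !addnS.
rewrite big_set1_support => [|A A1]; last first.
  by rewrite big1 // => B _; rewrite cy ?A1 ?mul0r.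
apply: eq_bigr => a _; rewrite big_set1_support => [|B B1];
  last by rewrite cy ?B1 ?orbT ?mul0r.
by apply: eq_bigr => b _; rewrite face_label1.
Qed.

(** The component of [x] in multidegree [u]. The basis vector [[A, B]] has the
    multidegree of its label, which is why the coefficient is taken at the
    difference. *)
Definition strand u d (x : chain k m n d.+1) A B : k :=
  if biclique (degree_graph u) A B then (coef_at x A B)@_(u - face_label w A B) else 0.

Lemma strand_supported u d (x : chain k m n d.+1) :
  biclique_supported (degree_graph u) (strand u x).
Proof. by move=> A B /negbTE AB; rewrite /strand AB. Qed.

Lemma strand_degree u d (x : chain k m n d.+1) A B :
  (#|A| + #|B|)%N != d.+2 -> strand u x A B = 0.
Proof.
move=> AB; rewrite /strand coef_at0 ?mcoeff0 ?if_same //.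
by rewrite /is_face /= (negbTE AB) !andbF.
Qed.

Lemma strandD u d (x y : chain k m n d.+1) A B :
  strand u (x + y) A B = strand u x A B + strand u y A B.
Proof.
rewrite /strand; case: ifP => _; last by rewrite addr0.
by rewrite /coef_at; case: insub => [c|]; rewrite ?ffunE ?mcoeffD ?mcoeff0 ?addr0.
Qed.

Lemma strand0 u d A B : strand u (0 : chain k m n d.+1) A B = 0.
Proof.
by rewrite /strand /coef_at; case: insub => [c|]; rewrite ?ffunE mcoeff0 if_same.
Qed.

(** A chain is the sum of its multihomogeneous components. *)
Lemma strand_inj d (x y : chain k m n d.+1) :
  (forall u A B, A != set0 -> B != set0 -> strand u x A B = strand u y A B) -> x = y.
Proof.
move=> xy; apply/ffunP => c; apply/mpolyP => e.
have /and3P[A0 B0 _] := valP c;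
  have := xy (e + face_label w (val c).1 (val c).2)%MM _ _ A0 B0.
by rewrite /strand biclique_label A0 B0 lem_addl !coef_at_face addmK.
Qed.

(** The differential is multihomogeneous, and in multidegree [u] its monomial
    entries become signs. *)
Lemma strand_boundary u d (y : chain k m n d.+2) A B :
  A != set0 -> B != set0 ->
  strand u (boundary w y) A B = biclique_bd (strand u y) A B.
Proof.
move=> A0 B0; have [AB|nAB] := boolP (biclique (degree_graph u) A B); last first.
  by rewrite strand_supported // (biclique_bd_supported (@strand_supported u _ y)).
have lu : (face_label w A B <= u)%MM by move: AB; rewrite biclique_label => /and3P[].
rewrite {1}/strand AB coef_at_boundary //.
have coefE r (p : S) C D : A \subset C -> B \subset D ->
    ((-1) ^+ r * (p * 'X_[face_label w C D - face_label w A B]))@_(u - face_label w A B)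
    = (-1) ^+ r * if biclique (degree_graph u) C D then p@_(u - face_label w C D)
      else 0.
  move=> sA sB; rewrite mcoeff_sign mcoeff_mulX.
  have lCD := face_labelS sA sB.
  have sub0 (T : finType) (X Y : {set T}) : X \subset Y -> X != set0 -> Y != set0.
    by move=> XY; apply: contraNneq => Y0; rewrite Y0 subset0 in XY.
  rewrite biclique_label (sub0 _ _ _ sA) // (sub0 _ _ _ sB) //=.
  have -> : (face_label w C D - face_label w A B <= u - face_label w A B
              = (face_label w C D <= u))%MM.
    apply/mnm_lepP/mnm_lepP => h i; move: (h i); rewrite ?mnmBE leq_sub2rE //;
      exact: (mnm_lepP lu).
  suff -> : (u - face_label w A B - (face_label w C D - face_label w A B)
              = u - face_label w C D)%MM by [].
  apply/mnmP => i; rewrite !mnmBE subnBA ?subnK //.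
    exact: (mnm_lepP lu).
  exact: (mnm_lepP lCD).
rewrite mcoeffD mcoeff_sign !raddf_sum /biclique_bd /simplex_bd.
congr (_ + _ * _); apply: eq_bigr => x _; rewrite /= coefE //; exact: subsetUr.
Qed.

Lemma augmentation_strand u (y : chain k m n 1) :
  augmentation (strand u y) = (boundary w y tt)@_u.
Proof.
rewrite boundary1E raddf_sum; apply: eq_bigr => a _; rewrite raddf_sum.
apply: eq_bigr => b _; rewrite /= mcoeff_mulX /strand biclique_label face_label1.
by rewrite -!card_gt0 !cards1.
Qed.

(** In homological degree 1 only the augmentation of a strand can be nonzero, in
    higher degrees only its boundary. *)
Lemma boundary_eq0P d (z : chain k m n d.+1) :
  boundary w z = 0 <-> forall u, biclique_cycle (strand u z).
Proof.
case: d z => [|d] z.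
  split=> [dz u|cz].
    split=> [A B A0 B0|]; last by rewrite augmentation_strand dz ffunE mcoeff0.
    rewrite /biclique_bd !simplex_bd0 ?mulr0 ?addr0 // => x xA; apply: strand_degree;
    rewrite cardsU1 xA; move: A0 B0; rewrite -!card_gt0;
    by case: #|A| => // p _; case: #|B| => // q _; rewrite ?addSn ?addnS.
  apply/ffunP => -[]; apply/mpolyP => u.
  by rewrite -augmentation_strand (cz u).2 ffunE mcoeff0.
split=> [dz u|cz]; last first.
  apply: strand_inj => u A B A0 B0.
  by rewrite strand_boundary // (cz u).1 // strand0.
split=> [A B A0 B0|]; first by rewrite -strand_boundary // dz strand0.
rewrite /augmentation big1 // => a _; rewrite big1 // => b _.
by rewrite strand_degree // !cards1.
Qed.

(** The chain concentrated in multidegree [u] with given component, truncated to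
    one homological degree. *)
Definition place u d (y : {set 'I_m} -> {set 'I_n} -> k) : chain k m n d.+1 :=
  [ffun c : face m n d.+1 =>
    y (val c).1 (val c).2 *: 'X_[u - face_label w (val c).1 (val c).2]].

Lemma strand_place u u' d y A B :
  biclique_supported (degree_graph u) y -> (#|A| + #|B|)%N = d.+2 ->
  strand u' (place u d y) A B = if u' == u then y A B else 0.
Proof.
move=> ys AB; rewrite /strand; case: ifPn => [cl'|ncl]; last first.
  by case: eqP ncl => // -> /ys->.
have /and3P[A0 B0 lu'] : [&& A != set0, B != set0 & (face_label w A B <= u')%MM].
  by rewrite -biclique_label.
have f : is_face d.+1 (A, B) by rewrite /is_face A0 B0 AB eqxx.
rewrite /coef_at insubT ffunE mcoeffZ mcoeffX /=.
have [cl|ncl] := boolP (biclique (degree_graph u) A B); last first.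
  by rewrite ys // mul0r if_same.
have lu : (face_label w A B <= u)%MM by move: cl; rewrite biclique_label => /and3P[].
have [->|uu] := eqVneq u' u; first by rewrite eqxx mulr1.
rewrite (_ : (_ == _) = false) ?mulr0 //; apply/negbTE; apply: contra uu => /eqP E.
by rewrite -(submK lu) -(submK lu') E.
Qed.

Lemma resolution_degree0 (p : S) :
  (exists x : chain k m n 1, boundary w x = [ffun=> p]) <-> edge_ideal w p.
Proof.
split=> [[x /ffunP/(_ tt)]|[c ->]].
  rewrite boundary1E ffunE => <-.
  exists (fun e => coef_at x [set e.1] [set e.2]).
  by rewrite pair_bigA; apply: eq_bigr => e _; rewrite vertex_labelE.
exists [ffun f : face m n 1 => \sum_(e | val f == ([set e.1], [set e.2])) c e].
apply/ffunP => -[]; rewrite boundary1E ffunE pair_bigA; apply: eq_bigr => -[a b] _.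
have f : is_face 1 ([set a], [set b]) by rewrite /is_face -!card_gt0 !cards1.
rewrite /coef_at insubT ffunE (big_pred1 (a, b)) ?vertex_labelE // => -[a' b'] /=.
by rewrite !xpair_eqE !(inj_eq set1_inj) eq_sym [b == _]eq_sym.
Qed.

(** A chain meets only finitely many multidegrees; a bounding chain is built one
    multidegree at a time, which avoids choosing all bounding strands at
    once. *)
Lemma acyclic_exact d (z : chain k m n d.+1) :
  (forall u, acyclic k (degree_graph u)) -> boundary w z = 0 ->
  exists y : chain k m n d.+2, boundary w y = z.
Proof.
move=> acG /boundary_eq0P cz.
have claim (s : seq 'X_{1..m + n}) : uniq s ->
    exists y : chain k m n d.+2, forall u A B, A != set0 -> B != set0 ->
    biclique_bd (strand u y) A B = if u \in s then strand u z A B else 0.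
  elim: s => [_|u0 s IHs /= /andP[u0s /IHs[y dy]]].
    exists 0 => u A B A0 B0; rewrite /biclique_bd !simplex_bd0 ?mulr0 ?addr0 //;
    by move=> *; rewrite strand0.
  have [y0 ys0 dy0] := acG u0 d.+2 _ (@strand_supported u0 _ z)
    (@strand_degree u0 _ z) (cz u0).
  exists (y + place u0 d.+1 y0) => u A B A0 B0.
  have [AB|nAB] := eqVneq (#|A| + #|B|)%N d.+2; last first.
    by rewrite -strand_boundary // !strand_degree // if_same.
  have -> : biclique_bd (strand u (y + place u0 d.+1 y0)) A B =
      biclique_bd (strand u y) A B + if u == u0 then biclique_bd y0 A B else 0.
    transitivity (biclique_bd (fun A B =>
      strand u y A B + if u == u0 then y0 A B else 0) A B).
      congr (_ + _ * _); apply: eq_simplex_bd => x xA; rewrite strandD strand_place //;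
        by rewrite cardsU1 xA ?addnS ?addSn ?AB // -AB addnS.
    rewrite biclique_bdD; congr (_ + _); case: eqP => // _.
    by rewrite /biclique_bd !simplex_bd0 ?mulr0 ?addr0.
  rewrite dy // inE; have [->|_] /= := eqVneq u u0; last by rewrite addr0.
  by rewrite (negbTE u0s) add0r dy0.
(* The multidegrees in which [z] has a nonzero component. *)
pose s := undup (flatten [seq
   [seq (e + face_label w (val c).1 (val c).2)%MM | e <- msupp (z c)]
   | c : face m n d.+1]).
have [y dy] := claim s (undup_uniq _).
exists y; apply: strand_inj => u A B A0 B0; rewrite strand_boundary // dy //.
case: ifPn => // us; rewrite /strand; case: ifP => // cl; rewrite /coef_at.
case: insubP => [c _ cE|_]; last by rewrite mcoeff0.
apply/esym/memN_msupp_eq0; apply: contra us => eS; rewrite mem_undup.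
apply/flatten_mapP; exists c; first by rewrite mem_enum.
apply/mapP; exists (u - face_label w A B)%MM; rewrite // cE submK //.
by move: cl; rewrite biclique_label => /and3P[].
Qed.

(** A cycle in the strand of degree [u], placed in that degree, is a cycle of
    Visscher's complex; the strand of a bounding chain bounds it. *)
Lemma exact_acyclic u :
  (forall d (z : chain k m n d.+1), boundary w z = 0 ->
     exists y : chain k m n d.+2, boundary w y = z) ->
  acyclic k (degree_graph u).
Proof.
move=> ex d z zs zd zc.
(* Faces consist of two nonempty sets, so there are none of total size below 2. *)
have [d2|] := leqP 2 d; last first.
  move=> d2; exists (fun _ _ => 0) => // A B A0 B0.
  rewrite /biclique_bd !simplex_bd0 ?mulr0 ?addr0 // zd //.
  move: A0 B0; rewrite -!card_gt0 => A0 B0; rewrite gtn_eqF //.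
  by apply: leq_trans d2 _; rewrite -[2%N]/(1 + 1)%N leq_add.
case: d d2 zd => [|[|d]] // _ zd.
have zE u' A B : strand u' (place u d z) A B = if u' == u then z A B else 0.
  have [AB|nAB] := eqVneq (#|A| + #|B|)%N d.+2; first exact: strand_place.
  by rewrite strand_degree // zd // if_same.
have [|y dy] := ex d (place u d z).
  apply/boundary_eq0P => u'; have [uu|nuu] := eqVneq u' u.
    by apply: eq_biclique_cycle zc => A B _ _; rewrite zE uu eqxx.
  split=> [A B A0 B0|].
    by rewrite /biclique_bd !simplex_bd0 ?mulr0 ?addr0 // => x _;
      rewrite zE (negbTE nuu).
  by rewrite /augmentation big1 // => a _; rewrite big1 // => b _;
    rewrite zE (negbTE nuu).
exists (strand u y); first exact: strand_supported.
by move=> A B A0 B0; rewrite -strand_boundary // dy zE eqxx.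
Qed.

Lemma boundary_boundary d (y : chain k m n d.+2) : boundary w (boundary w y) = 0.
Proof.
apply/boundary_eq0P => u; apply: eq_biclique_cycle (biclique_bd_is_cycle (strand u y)).
by move=> A B A0 B0; rewrite strand_boundary.
Qed.

(** Homology can be computed in each multidegree, and the bounds [x] and [y]
    together are the exponent vectors. *)
Lemma is_resolutionP :
  is_resolution k w <-> forall x y, acyclic k (threshold x y).
Proof.
split=> [[_ ex] x y|acG].
  pose u : 'X_{1..m + n} :=
    [multinom match split i with inl a => x a | inr b => y b end | i < m + n].
  apply: (@eq_acyclic _ _ _ (degree_graph u)); last first.
    by apply: exact_acyclic => d z /ex.
  move=> a b; rewrite /degree_graph /threshold !mnmE.
  by rewrite (unsplitK (inl a)) (unsplitK (inr b)).
split=> [p|d z]; first exact: resolution_degree0.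
split=> [dz|[y <-]]; last exact: boundary_boundary.
by apply: acyclic_exact => // u; apply: acG.
Qed.

End Strand.

(** * Minimality *)

Section InIdeal.

Variables (R : comNzRingType) (I : finType) (f : I -> R).

Lemma in_ideal0 : in_ideal f 0.
Proof. by exists (fun=> 0); rewrite big1 // => i _; rewrite mul0r. Qed.

Lemma in_idealD p q : in_ideal f p -> in_ideal f q -> in_ideal f (p + q).
Proof.
move=> [c ->] [d ->]; exists (fun i => c i + d i).
by rewrite -big_split; apply: eq_bigr => i _; rewrite mulrDl.
Qed.

Lemma in_idealMl r p : in_ideal f p -> in_ideal f (r * p).
Proof.
move=> [c ->]; exists (fun i => r * c i).
by rewrite mulr_sumr; apply: eq_bigr => i _; rewrite mulrA.
Qed.

Lemma in_ideal_gen i : in_ideal f (f i).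
Proof.
exists (fun j => (j == i)%:R); rewrite (bigD1 i) //= eqxx mul1r big1 ?addr0 //.
by move=> j /negbTE->; rewrite mul0r.
Qed.

Lemma in_ideal_sum (J : finType) (P : pred J) (F : J -> R) :
  (forall j, P j -> in_ideal f (F j)) -> in_ideal f (\sum_(j | P j) F j).
Proof. by move=> fF; apply: big_ind => //; [apply: in_ideal0|apply: in_idealD]. Qed.

End InIdeal.

Lemma mpolyX_in_vars (R : comNzRingType) N (e : 'X_{1..N}) i :
  (0 < e i)%N -> in_ideal (fun j : 'I_N => 'X_j : {mpoly R[N]}) 'X_[e].
Proof.
move=> ei; have -> : e = (e - U_(i) + U_(i))%MM.
  by rewrite submK // lep1mP -lt0n.
by rewrite mpolyXD; apply/in_idealMl/in_ideal_gen.
Qed.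

Section Minimal.

Variables (k : fieldType) (m n : nat) (w : 'I_m -> 'I_n -> nat).
Hypothesis w_gt0 : edge_weighting w.
Implicit Types (A : {set 'I_m}) (B : {set 'I_n}).

Lemma face_label_gt0 A B a b :
  a \in A -> b \in B ->
  (0 < face_label w A B (lshift n a))%N /\ (0 < face_label w A B (rshift m b))%N.
Proof.
move=> aA bB; have := lepm_refl (face_label w A B).
rewrite {1}face_label_le => /forall_inP/(_ a aA)/forall_inP/(_ b bB)/andP[wa wb].
by split; apply: leq_trans (w_gt0 a b) _.
Qed.

(** Lowering this exponent of the label to 0 leaves a common multiple of the
    vertex labels, so it was 0 by minimality of the least common multiple. *)
Lemma face_label_lshift0 A B a : a \notin A -> face_label w A B (lshift n a) = 0%N.
Proof.
move=> aA.
pose u := [multinom if j == lshift n a then 0%N else face_label w A B j | j < m + n].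
suff /mnm_lepP/(_ (lshift n a)) : (face_label w A B <= u)%MM.
  by rewrite mnmE eqxx leqn0 => /eqP.
have := lepm_refl (face_label w A B); rewrite {1}face_label_le => /forall_inP AB.
rewrite face_label_le; apply/forall_inP => a' aA'; apply/forall_inP => b bB.
have /andP[wa wb] := forall_inP (AB a' aA') b bB.
rewrite /degree_graph /threshold !mnmE eq_rlshift (inj_eq (@lshift_inj _ _)) ifN ?wa //.
by apply: contraNneq aA => <-.
Qed.

Lemma face_label_rshift0 A B b : b \notin B -> face_label w A B (rshift m b) = 0%N.
Proof.
move=> bB.
pose u := [multinom if j == rshift m b then 0%N else face_label w A B j | j < m + n].
suff /mnm_lepP/(_ (rshift m b)) : (face_label w A B <= u)%MM.
  by rewrite mnmE eqxx leqn0 => /eqP.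
have := lepm_refl (face_label w A B); rewrite {1}face_label_le => /forall_inP AB.
rewrite face_label_le; apply/forall_inP => a aA; apply/forall_inP => b' bB'.
have /andP[wa wb] := forall_inP (AB a aA) b' bB'.
rewrite /degree_graph /threshold !mnmE eq_lrshift (inj_eq (@rshift_inj _ _)) wa
  /= ifN ?wb //.
by apply: contraNneq bB => <-.
Qed.

(** An entry at [a] still contains the full positive power of [X_a] (or [Y_b])
    of the larger label, because the smaller label does not contain that
    variable. *)
Lemma visscher_minimal : is_minimal k w.
Proof.
case=> [|d] [[A B] /= f] c'; have /and3P[/set0Pn[a aA] /set0Pn[b bB] _] := f.
  by apply: (@mpolyX_in_vars _ _ _ (lshift n a)); rewrite (face_label_gt0 aA bB).1.
apply: in_idealD; apply: in_ideal_sum => x /andP[xA _]; apply: in_idealMl.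
  apply: (@mpolyX_in_vars _ _ _ (lshift n x)).
  by rewrite mnmBE [X in (_ - X)%N]face_label_lshift0
    ?setD11 // subn0 (face_label_gt0 xA bB).1.
apply: (@mpolyX_in_vars _ _ _ (rshift m x)).
by rewrite mnmBE [X in (_ - X)%N]face_label_rshift0
  ?setD11 // subn0 (face_label_gt0 aA xA).2.
Qed.

Lemma visscher_resolutionP :
  visscher_resolution k w <-> forall x y, acyclic k (threshold w x y).
Proof.
by split=> [[/is_resolutionP]|acG] //; split;
  [apply/is_resolutionP|apply: visscher_minimal].
Qed.

End Minimal.

(** * Vertices whose edges all have minimal weight *)

Section Combinatorics.

Variables (k : fieldType).

Lemma acyclic_threshold_transpose m n (w : 'I_m -> 'I_n -> nat) :
  (forall x y, acyclic k (threshold w x y)) <->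
  (forall x y, acyclic k (threshold (fun b a => w a b) x y)).
Proof.
split=> acG x y; apply: eq_acyclic (acyclic_transpose (acG y x)) => b a;
  by rewrite /threshold andbC.
Qed.

Lemma acyclic_threshold_star n (w : 'I_1 -> 'I_n -> nat) x y :
  acyclic k (threshold w x y).
Proof. by apply: (@acyclic_dominating _ _ _ _ ord0) => a b; rewrite ord1. Qed.

(** Threshold 0 isolates a vertex, as weights are positive. *)
Lemma acyclic_threshold_del m n (w : 'I_m -> 'I_n -> nat) i :
  edge_weighting w ->
  (forall x y, acyclic k (threshold w x y)) ->
  (forall x y, acyclic k (threshold (fun a b => w (lift i a) b) x y)).
Proof.
move=> w_gt0 acG x y; pose x' a := if unlift i a is Some a' then x a' else 0%N.
have iso b : ~~ threshold w x' y i b.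
  by rewrite /threshold /x' unlift_none leqNgt w_gt0.
apply: eq_acyclic ((acyclic_isolated k iso).1 (acG x' y)) => a b.
by rewrite /threshold /x' liftK.
Qed.

(** Below [alpha] the vertex [i] is isolated. From [alpha] on it dominates: a
    vertex [b] with any edge has threshold at least [alpha], hence an edge to
    [i]. *)
Lemma acyclic_threshold_add m n (w : 'I_m -> 'I_n -> nat) alpha i :
  (forall a b, (alpha <= w a b)%N) -> (forall b, w i b = alpha) ->
  (forall x y, acyclic k (threshold (fun a b => w (lift i a) b) x y)) ->
  (forall x y, acyclic k (threshold w x y)).
Proof.
move=> min_a wi acG x y; have [ax|xa] := leqP alpha (x i).
  apply: (@acyclic_dominating _ _ _ _ i) => a b /andP[_ wy].
  by rewrite /threshold wi ax (leq_trans (min_a a b)).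
have iso b : ~~ threshold w x y i b by rewrite /threshold wi leqNgt xa.
apply/(acyclic_isolated k iso); exact: acG (fun a => x (lift i a)) y.
Qed.

(** Otherwise [j'] and [i'] with [w i j' > alpha] and [w i' j > alpha] exist,
    and the thresholds [alpha] on [i, j] and [w i' j'] on [i', j'] cut out two
    disjoint edges. The thresholds on [i] and [j] exclude the cross edges,
    whatever [w i' j'] is. *)
Lemma min_edge_dominated m n (w : 'I_m -> 'I_n -> nat) alpha i j :
  edge_weighting w -> (forall a b, (alpha <= w a b)%N) -> w i j = alpha ->
  (forall x y, acyclic k (threshold w x y)) ->
  (forall b, w i b = alpha) \/ (forall a, w a j = alpha).
Proof.
move=> w_gt0 min_a wij acG.
have lt_a a b : w a b != alpha -> (alpha < w a b)%N.
  by rewrite ltn_neqAle min_a andbT eq_sym.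
case: (boolP [forall b, w i b == alpha]) => [/forallP wi|]; first
  by left=> b; apply/eqP.
case: (boolP [forall a, w a j == alpha]) => [/forallP wj|]; first
  by right=> a; apply/eqP.
move=> /forallPn[i' /lt_a wi'j] /forallPn[j' /lt_a wij'].
have ii' : i' != i by apply: contraTneq wi'j => ->; rewrite wij ltnn.
have jj' : j' != j by apply: contraTneq wij' => ->; rewrite wij ltnn.
(* Threshold 0 isolates all other vertices. *)
pose x a := if a == i then alpha else if a == i' then w i' j' else 0%N.
pose y b := if b == j then alpha else if b == j' then w i' j' else 0%N.
exfalso; move: (acG x y).
apply: (@isolated_edge_not_acyclic k _ _ _ i j i' j' _ _ _ ii').
- move=> b; rewrite /threshold /x /y eqxx; have [->|bj] := eqVneq b j.
    by rewrite wij leqnn.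
  have [->|bj'] := eqVneq b j'; first by rewrite leqNgt wij'.
  by rewrite leqn0 eqn0Ngt w_gt0 andbF.
- move=> a; rewrite /threshold /x /y eqxx; have [->|ai] := eqVneq a i.
    by rewrite wij leqnn.
  have [->|ai'] := eqVneq a i'; first by rewrite andbC leqNgt wi'j.
  by rewrite leqn0 eqn0Ngt w_gt0.
- by rewrite /threshold /x /y (negbTE ii') (negbTE jj') !eqxx leqnn.
Qed.

End Combinatorics.

Theorem theorem1p7 (m n : nat) (k : fieldType) (w : 'I_m -> 'I_n -> nat)
    (alpha : nat) :
  (1 <= m)%N -> (1 <= n)%N ->
  edge_weighting w ->
  is_min_weight w alpha ->
  visscher_resolution k w <->
  ((m = 1%N \/ n = 1%N) \/
   ((2 <= m)%N /\ (2 <= n)%N /\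
    exists v : vertex m n,
      (forall u : vertex m n, adjacent v u -> weight w v u = alpha) /\
      visscher_resolution_del k w v)).
Proof.
move=> m1 n1 w_gt0 [[i [j wij]] min_a].
have w_gt0T : edge_weighting (fun b a => w a b) by move=> b a; apply: w_gt0.
have delX a : visscher_resolution_del k w (inl a) <->
    forall x y, acyclic k (threshold (fun a' b => w (lift a a') b) x y).
  by apply: visscher_resolutionP => a' b; apply: w_gt0.
have delY b : visscher_resolution_del k w (inr b) <->
    forall x y, acyclic k (threshold (fun b' a => w a (lift b b')) x y).
  rewrite -(acyclic_threshold_transpose k (fun a b' => w a (lift b b'))).
  by apply: visscher_resolutionP => a b'; apply: w_gt0.
rewrite visscher_resolutionP //; split=> [acG|[[E|E]|[_ [_ [[v|v] [wv]]]]]].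
- case: (ltnP 1 m) => m2; last by left; left; apply/eqP; rewrite eqn_leq m2.
  case: (ltnP 1 n) => n2; last by left; right; apply/eqP; rewrite eqn_leq n2.
  right; split=> //; split=> //.
  have [wi|wj] := min_edge_dominated w_gt0 min_a wij acG.
    exists (inl i); split; first by case=> // b _; apply: wi.
    by apply/delX; apply: acyclic_threshold_del.
  exists (inr j); split; first by case=> // a _; apply: wj.
  apply/delY; apply: (acyclic_threshold_del w_gt0T).
  exact/acyclic_threshold_transpose.
- by subst m; apply: acyclic_threshold_star.
- by subst n; apply/acyclic_threshold_transpose/acyclic_threshold_star.
- move/delX; apply: acyclic_threshold_add min_a _ => b; exact: (wv (inr b)).
- move/delY=> acG; apply/acyclic_threshold_transpose; move: acG.
  by apply: (@acyclic_threshold_add _ _ _ _ alpha) => [b a|a];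
    [apply: min_a|apply: (wv (inl a))].
Qed.
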